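(* Let $s,t$ be positive integers and $m_i$ ($i<s$), $n_j$ ($j<t$) positive integers. Let $M_0, \ldots, M_{s-1}$ be linear orders each equal to $\omega$ or $\omega^*$ which alternate, and likewise $N_0, \ldots, N_{t-1}$, with $M_0 = \omega$ if and only if $N_0 = \omega^*$. Let $A = M_0^{m_0} \cdot M_1^{m_1} \cdots M_{s-1}^{m_{s-1}}$ and $B = N_0^{n_0} \cdot N_1^{n_1} \cdots N_{t-1}^{n_{t-1}}$. Then if $s = 1$ or $t = 1$ (or both), $l(A,B) = 1$, and otherwise $l(A,B) = 2$.
   Context: $\omega^*$ is the reverse of $\omega$. For linear orders $X, Y$, $X \cdot Y$ is the anti-lexicographic product (''$Y$ copies of $X$''): pairs $(x,y)$ compared first by $y$, then by $x$; $M^n$ is the product of $n$ copies of $M$. For $n \ge 1$, $X \equiv_n Y$ means player II has a winning strategy in the $n$-move Ehrenfeucht–Fraïssé game on $X$ and $Y$. $l(X,Y)$ is the non-zero natural number $n$ with $X \equiv_n Y$ and $X \not\equiv_{n+1} Y$. *)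

(* Defs.v *)
From HB Require Import structures.
From mathcomp Require Import all_boot all_order.

Set Implicit Arguments.
Unset Strict Implicit.
Unset Printing Implicit Defensive.

Import Order.TTheory.
Local Open Scope order_scope.

(* Bundling the display lets orders carrying different displays (nat, its dual,
   lexicographic products) share one type, so that products can be iterated. *)
Structure linorder := LinOrder {
  lo_disp : Order.disp_t;
  lo_sort :> orderType lo_disp }.

Definition omega : linorder := LinOrder nat.
Definition omega_star : linorder := LinOrder nat^d.

Inductive omega_type := Omega | OmegaStar.

Coercion linorder_of (b : omega_type) : linorder :=
  match b with Omega => omega | OmegaStar => omega_star end.

(* The anti-lexicographic product ("Y copies of X"): the library order *l
   compares first components first, so the pair (x, y) is stored as (y, x). *)
Definition antilex (X Y : linorder) : linorder := LinOrder (Y *l X).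

Lemma antilex_leE (X Y : linorder) (x x' : X) (y y' : Y) :
  (((y, x) : antilex X Y) <= (y', x')) =
  (y < y') || ((y == y') && (x <= x')).
Proof.
rewrite /= (@lexi_pair _ _ _ Y X y y' x x').
by case: (ltgtP y y').
Qed.

(* F 0 . F 1 ... F (n - 1), associated to the left; the empty product is the
   one-point order. *)
Fixpoint lo_prod (F : nat -> linorder) (n : nat) : linorder :=
  match n with
  | 0 => LinOrder 'I_1
  | 1 => F 0
  | n'.+1 => antilex (lo_prod F n') (F n')
  end.

Definition lo_exp (X : linorder) (n : nat) : linorder :=
  lo_prod (fun=> X) n.

Section EhrenfeuchtFraisse.
Variables X Y : linorder.

(* A strategy for player II: given the earlier moves of player I and the current
   one, a reply in the order that player I did not choose. *)
Record strategy := Strategy {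
  reply_right : seq (X + Y) -> X -> Y;
  reply_left : seq (X + Y) -> Y -> X }.

Fixpoint play (sigma : strategy) (past moves : seq (X + Y)) : seq (X * Y) :=
  match moves with
  | [::] => [::]
  | inl x :: moves' =>
      (x, reply_right sigma past x) :: play sigma (rcons past (inl x)) moves'
  | inr y :: moves' =>
      (reply_left sigma past y, y) :: play sigma (rcons past (inr y)) moves'
  end.

(* The orders being linear, preserving and reflecting <= does the same for
   both = and <. *)
Definition partial_iso (ps : seq (X * Y)) : Prop :=
  forall p q : X * Y, p \in ps -> q \in ps -> (p.1 <= q.1) = (p.2 <= q.2).

Definition winning (n : nat) (sigma : strategy) : Prop :=
  forall moves : seq (X + Y), size moves = n ->
    partial_iso (play sigma [::] moves).

Definition ef_equiv (n : nat) : Prop := exists sigma, winning n sigma.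

(* l(X, Y) = n; a relation because l is a partial function (see
   ef_length_inj). *)
Definition ef_length (n : nat) : Prop :=
  [/\ (0 < n)%N, ef_equiv n & ~ ef_equiv n.+1].

Lemma play_cat sigma past u v :
  play sigma past (u ++ v) = play sigma past u ++ play sigma (past ++ u) v.
Proof.
elim: u past => [|[x|y] u IH] past /=; first by rewrite cats0.
- by rewrite IH cat_rcons.
- by rewrite IH cat_rcons.
Qed.

Lemma ef_equivS n : ef_equiv n.+1 -> ef_equiv n.
Proof.
case=> sigma win; exists sigma => -[|m ms] sz p q pin qin //.
have sz' : size ((m :: ms) ++ [:: m]) = n.+1 by rewrite size_cat sz addn1.
by apply: (win _ sz'); rewrite play_cat mem_cat ?pin ?qin.
Qed.

Lemma ef_equiv_leq n k : (n <= k)%N -> ef_equiv k -> ef_equiv n.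
Proof.
move/subnK <-; elim: (k - n)%N => [|d IH] //.
by rewrite addSn => /ef_equivS.
Qed.

Lemma ef_length_inj n k : ef_length n -> ef_length k -> n = k.
Proof.
case=> _ en nen [_ ek nek]; case: (ltngtP n k) => // lt.
- by case: nen; apply: ef_equiv_leq ek.
- by case: nek; apply: ef_equiv_leq en.
Qed.

End EhrenfeuchtFraisse.

(* Main.v *)
Require Import Defs.
From mathcomp Require Import all_boot all_order.

(** Say M 0 = omega and N 0 = omega*; the other case is the mirror image. Every
element of B has an immediate predecessor, while a point of A with coordinate 0
in each omega factor of M 0 ^ m 0 has none: three moves tell A and B apart.
When s >= 2 and t >= 2 neither order has an end point, so player II survives
two moves. When s = 1 the order A has a least element and B has none, and when
t = 1 the order B has a greatest element and A has none: two moves suffice. *)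

Set Implicit Arguments.
Unset Strict Implicit.
Unset Printing Implicit Defensive.

Import Order.TTheory.
Local Open Scope order_scope.

(** * Order properties read in a direction *)

Definition opp (b : omega_type) : omega_type :=
  if b is Omega then OmegaStar else Omega.

Lemma oppK b : opp (opp b) = b.
Proof. by case: b. Qed.

Lemma neq_opp b c : b <> c -> c = opp b.
Proof. by case: b; case: c. Qed.

(* The strict order read in direction [b]: it makes the two mirror-image cases
   of each argument instances of a single one. *)
Definition lt_dir (b : omega_type) (X : linorder) (x y : X) : bool :=
  if b is Omega then x < y else y < x.

Lemma lt_dir_opp b (X : linorder) (x y : X) : lt_dir (opp b) x y = lt_dir b y x.
Proof. by case: b. Qed.

Lemma lt_dir_antilex b (X Y : linorder) (x x' : X) (y y' : Y) :
  lt_dir b ((y, x) : antilex X Y) (y', x') =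
  lt_dir b y y' || (y == y') && lt_dir b x x'.
Proof.
by case: b; rewrite /lt_dir ltNge antilex_leE negb_or negb_and -leNgt -ltNge;
  [case: (ltgtP y y') | case: (ltgtP y y')].
Qed.

Definition unbounded (b : omega_type) (X : linorder) : Prop :=
  forall x : X, exists y, lt_dir b x y.

Definition has_origin (b : omega_type) (X : linorder) : Prop :=
  exists x : X, forall y, ~~ lt_dir b y x.

Definition has_succs (b : omega_type) (X : linorder) : Prop :=
  forall x : X, exists2 y, lt_dir b x y &
    forall z, ~~ (lt_dir b x z && lt_dir b z y).

(* An origin counts as a limit point. *)
Definition has_limit (b : omega_type) (X : linorder) : Prop :=
  exists x : X, forall y, lt_dir b y x -> exists z, lt_dir b y z && lt_dir b z x.

Lemma has_succs_omega b : has_succs b b.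
Proof.
by case: b => x; exists x.+1 => [|z]; rewrite /lt_dir ?ltEdual ?ltEnat /= ?ltnSn //
  -?ltEnat; case: (ltngtP x z) => // h; rewrite ?andbF // ?andbT -leqNgt.
Qed.

Lemma has_origin_omega b : has_origin b b.
Proof. by case: b; exists 0%N. Qed.

Lemma has_succs_unbounded b X : has_succs b X -> unbounded b X.
Proof. by move=> sX x; have [y] := sX x; exists y. Qed.

Lemma has_origin_limit b X : has_origin b X -> has_limit b X.
Proof. by case=> x x0; exists x => y; rewrite (negbTE (x0 y)). Qed.

(** * Anti-lexicographic and iterated products *)

Section Antilex.
Variables (b : omega_type) (X Y : linorder).

Lemma inhabited_antilex : inhabited X -> inhabited Y -> inhabited (antilex X Y).
Proof. by move=> [x] [y]; split; exact: (y, x). Qed.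

Lemma unbounded_antilexl : unbounded b X -> unbounded b (antilex X Y).
Proof.
move=> uX [y x]; have [x' xx'] := uX x.
by exists (y, x'); rewrite lt_dir_antilex eqxx xx' orbT.
Qed.

Lemma unbounded_antilexr : unbounded b Y -> unbounded b (antilex X Y).
Proof.
move=> uY [y x]; have [y' yy'] := uY y.
by exists (y', x); rewrite lt_dir_antilex yy'.
Qed.

Lemma has_origin_antilex :
  has_origin b X -> has_origin b Y -> has_origin b (antilex X Y).
Proof.
move=> [x x0] [y y0]; exists (y, x) => -[y' x'].
by rewrite lt_dir_antilex (negbTE (y0 y')) (negbTE (x0 x')) andbF.
Qed.

(** The successor stays in the same copy of [X], and copies are convex, so no point of another copy
    falls in between. *)
Lemma has_succs_antilex : has_succs b X -> has_succs b (antilex X Y).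
Proof.
move=> sX [y x]; have [x' xx' nx] := sX x.
exists (y, x'); first by rewrite lt_dir_antilex eqxx xx' orbT.
case=> y' z; rewrite !lt_dir_antilex; have := nx z.
by case: b => /=; case: (ltgtP y y').
Qed.

(** A limit point [x] of [X] stays one in any copy: a point before it in the same copy is handled by
    [X], and one in an earlier copy is followed by more points of its own copy because [X] is
    unbounded. *)
Lemma has_limit_antilex :
  unbounded b X -> has_limit b X -> inhabited Y -> has_limit b (antilex X Y).
Proof.
move=> uX [x lx] [y]; exists (y, x) => -[y' x'].
rewrite lt_dir_antilex => /orP[yy'|/andP[/eqP-> /lx[z /andP[xz zx]]]].
  have [z xz] := uX x'.
  by exists (y', z); rewrite !lt_dir_antilex yy' eqxx xz orbT.
by exists (y, z); rewrite !lt_dir_antilex eqxx xz zx !orbT.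
Qed.

End Antilex.

(** Induction on the factors adjoined on the right, started once the factor [F k] that supplies the
    property is present. *)
Lemma lo_prod_ind (P Q : linorder -> Prop) (F : nat -> linorder) k n :
  (forall X Y, P X -> Q Y -> P (antilex X Y)) -> (forall i, Q (F i)) ->
  P (lo_prod F k.+1) -> (k < n)%N -> P (lo_prod F n).
Proof.
move=> PQ QF Pk; elim: n => // n IH; rewrite ltnS leq_eqVlt.
case/orP=> [/eqP<- //|kn]; have := PQ _ _ (IH kn) (QF n).
(* A product of one factor is [F 0] itself, not an [antilex]; [kn] rules out [n = 0]. *)
by case: n kn {IH}.
Qed.

Lemma inhabited_lo_prod (F : nat -> linorder) n :
  (forall i, inhabited (F i)) -> inhabited (lo_prod F n).
Proof.
case: n => [|n] iF; first by split; exact: ord0.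
exact: (lo_prod_ind (k := 0) inhabited_antilex iF (iF 0%N)).
Qed.

Lemma inhabited_lo_exp (b : omega_type) n : inhabited (lo_exp b n).
Proof. by apply: inhabited_lo_prod => _; split; case: b; exact: 0%N. Qed.

(** * Powers and products of powers *)

Section Powers.
Variables (b : omega_type) (n : nat).
Hypothesis n_gt0 : (0 < n)%N.

Lemma has_succs_lo_exp : has_succs b (lo_exp b n).
Proof.
apply: (lo_prod_ind (k := 0) (Q := fun=> True)) => // [X Y sX _|].
  exact: has_succs_antilex.
exact: has_succs_omega.
Qed.

Lemma has_origin_lo_exp : has_origin b (lo_exp b n).
Proof.
exact: (lo_prod_ind (k := 0) (@has_origin_antilex b)
  (fun=> has_origin_omega b) (has_origin_omega b)).
Qed.

End Powers.

Section PowerProducts.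
Variables (M : nat -> omega_type) (m : nat -> nat) (s : nat).
Let A := lo_prod (fun i => lo_exp (M i) (m i)) s.
Hypothesis s_gt0 : (0 < s)%N.
Hypothesis m_gt0 : forall i, (i < s)%N -> (0 < m i)%N.

Let inhF i : inhabited (lo_exp (M i) (m i)) := inhabited_lo_exp (M i) (m i).

Lemma has_succs_power_prod : has_succs (M 0) A.
Proof.
apply: (lo_prod_ind (k := 0) (Q := fun=> True)) => // [X Y sX _|].
  exact: has_succs_antilex.
exact/has_succs_lo_exp/m_gt0.
Qed.

Lemma has_limit_power_prod : has_limit (M 0) A.
Proof.
(* Adjoining a factor preserves limit points only for an unbounded left factor, so both properties
   are carried together. *)
pose P X := unbounded (M 0) X /\ has_limit (M 0) X.
suff [] : P A by [].
apply: (lo_prod_ind (k := 0) (P := P) (Q := fun X => inhabited X) _ inhF)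
  => // [X Y [uX lX] iY|].
  by split; [exact: unbounded_antilexl | exact: has_limit_antilex].
split; first exact/has_succs_unbounded/has_succs_lo_exp/m_gt0.
exact/has_origin_limit/has_origin_lo_exp/m_gt0.
Qed.

(** The first factor gives unboundedness in its own direction, the second in the opposite one; later
    factors only take copies. *)
Lemma unbounded_power_prod : (1 < s)%N -> M 0 <> M 1 -> forall b, unbounded b A.
Proof.
move=> s_gt1 M01 b; have [->|] : b = M 0 \/ b = M 1.
- by rewrite (neq_opp M01); case: (M 0); case: b; (by left) || (by right).
- exact/has_succs_unbounded/has_succs_power_prod.
move=> ->; apply: (lo_prod_ind (k := 1) (Q := fun=> True)) => // [X Y uX _|].
  exact: unbounded_antilexl.
exact/unbounded_antilexr/has_succs_unbounded/has_succs_lo_exp/m_gt0.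
Qed.

End PowerProducts.

(** * Strategies in games of at most three moves *)

Lemma partial_iso_lt (X Y : linorder) (ps : seq (X * Y)) b p q :
  partial_iso ps -> p \in ps -> q \in ps ->
  lt_dir b p.1 q.1 = lt_dir b p.2 q.2.
Proof.
by move=> iso pin qin; case: b; rewrite /lt_dir !ltNge (iso _ _ pin qin) ||
  rewrite /lt_dir !ltNge (iso _ _ qin pin).
Qed.

Lemma partial_iso2 (X Y : linorder) (p q : X * Y) :
  (p.1 <= q.1) = (p.2 <= q.2) -> (q.1 <= p.1) = (q.2 <= p.2) ->
  partial_iso [:: p; q].
Proof.
move=> pq qp u v; rewrite !inE => /orP[]/eqP-> /orP[]/eqP->//.
- by rewrite !lexx.
- by rewrite !lexx.
Qed.

Definition swap_move (X Y : Type) (z : Y + X) : X + Y :=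
  match z with inl y => inr y | inr x => inl x end.

Definition swap_strategy (X Y : linorder) (sigma : strategy X Y) : strategy Y X :=
  Strategy (fun h => reply_left sigma (map (@swap_move X Y) h))
           (fun h => reply_right sigma (map (@swap_move X Y) h)).

Lemma play_swap (X Y : linorder) (sigma : strategy X Y) past moves :
  play (swap_strategy sigma) past moves =
  [seq (p.2, p.1) | p <- play sigma (map (@swap_move X Y) past)
                                    (map (@swap_move X Y) moves)].
Proof.
by elim: moves past => //= -[z|z] moves IH past; rewrite /= IH map_rcons.
Qed.

Lemma ef_equiv_sym (X Y : linorder) n : ef_equiv X Y n -> ef_equiv Y X n.
Proof.
case=> sigma win; exists (swap_strategy sigma) => moves sz; rewrite play_swap.
move=> _ _ /mapP[p pin ->] /mapP[q qin ->] /=.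
by apply/esym/(win _ _ p q pin qin); rewrite size_map.
Qed.

Lemma ef_equiv1 (X Y : linorder) : inhabited X -> inhabited Y -> ef_equiv X Y 1.
Proof.
move=> [x0] [y0]; exists (Strategy (fun _ _ => y0) (fun _ _ => x0)).
by case=> [|[z|z] []] //= _ p q; rewrite !inE => /eqP-> /eqP->; rewrite !lexx.
Qed.

Lemma unbounded_reply (X Y : linorder) :
  unbounded Omega Y -> unbounded OmegaStar Y ->
  {f : X -> Y -> X -> Y | forall x y x',
    (x <= x') = (y <= f x y x') /\ (x' <= x) = (f x y x' <= y)}.
Proof.
move=> up dn.
exists (fun x y x' => if x < x' then xchoose (up y)
                      else if x' < x then xchoose (dn y) else y) => x y x'.
have := xchooseP (up y); have := xchooseP (dn y); rewrite /lt_dir.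
case: (ltgtP x x') => _ lt1 lt2; last by rewrite !lexx.
- by rewrite (ltW lt2) leNgt lt2.
- by rewrite (ltW lt1) leNgt lt1.
Qed.

Lemma ef_equiv2 (X Y : linorder) : inhabited X -> inhabited Y ->
  (forall b, unbounded b X) -> (forall b, unbounded b Y) -> ef_equiv X Y 2.
Proof.
move=> [x0] [y0] uX uY.
have [f fP] := @unbounded_reply X Y (uY _) (uY _).
have [g gP] := @unbounded_reply Y X (uX _) (uX _).
exists (Strategy
  (fun past x' => match past with
    | [:: inl x] => f x y0 x' | [:: inr y] => f x0 y x' | _ => y0 end)
  (fun past y' => match past with
    | [:: inl x] => g y0 x y' | [:: inr y] => g y x0 y' | _ => x0 end)).
case=> [|u [|v []]] // _.
case: u => u; case: v => v /=; apply: partial_iso2 => /=.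
all: by [case: (fP u y0 v) | case: (gP y0 u v) | case: (fP x0 u v) |
         case: (gP u x0 v)].
Qed.

(** Player I plays the origin [x], then a point of [Y] before the reply; nothing in [X] precedes
    [x]. *)
Lemma not_ef_equiv2 (X Y : linorder) b :
  has_origin b X -> unbounded (opp b) Y -> ~ ef_equiv X Y 2.
Proof.
move=> [x x0] uY [sigma win].
have [y' yy'] := uY (reply_right sigma [::] x); rewrite lt_dir_opp in yy'.
have := partial_iso_lt b (win [:: inl x; inr y'] erefl) (mem_nth (x, y') (n := 1) _)
  (mem_nth (x, y') (n := 0) _).
by move=> /(_ isT isT) /=; rewrite yy' (negbTE (x0 _)).
Qed.

(** Player I plays a limit point [x], then the point [y'] just before the reply, then [z] strictly
    between the answer [x'] and [x]: no point of [Y] is left to match [z]. *)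
Lemma not_ef_equiv3 (X Y : linorder) b :
  has_limit b X -> has_succs (opp b) Y -> ~ ef_equiv X Y 3.
Proof.
move=> [x lx] sY [sigma win].
have [y'] := sY (reply_right sigma [::] x); rewrite lt_dir_opp => yy' ny.
set x' := reply_left sigma [:: inl x] y'.
have lt_nth z i j : (i < 3)%N -> (j < 3)%N ->
    let p := nth (x, y') (play sigma [::] [:: inl x; inr y'; inl z]) in
    lt_dir b (p i).1 (p j).1 = lt_dir b (p i).2 (p j).2.
  move=> lti ltj.
  by apply: (partial_iso_lt b (win [:: inl x; inr y'; inl z] erefl)); apply: mem_nth.
have /lx[z /andP[x'z zx]] : lt_dir b x' x.
  (* The first two rounds do not depend on the third move, so [x] serves as a placeholder for it. *)
  by have /= -> := lt_nth x 1%N 0%N isT isT.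
have := ny (reply_right sigma [:: inl x; inr y'] z); rewrite !lt_dir_opp.
have /= <- := lt_nth z 2%N 0%N isT isT; have /= <- := lt_nth z 1%N 2%N isT isT.
by rewrite zx -/x' x'z.
Qed.

Local Close Scope order_scope.

Theorem theorem3p1 (s t : nat) (m n : nat -> nat) (M N : nat -> omega_type)
  (s_gt0 : 0 < s) (t_gt0 : 0 < t)
  (m_gt0 : forall i : nat, i < s -> 0 < m i)
  (n_gt0 : forall j : nat, j < t -> 0 < n j)
  (M_alt : forall i : nat, i.+1 < s -> M i <> M i.+1)
  (N_alt : forall j : nat, j.+1 < t -> N j <> N j.+1)
  (MN0 : M 0 = Omega <-> N 0 = OmegaStar) :
  let A := lo_prod (fun i => lo_exp (M i) (m i)) s in
  let B := lo_prod (fun j => lo_exp (N j) (n j)) t in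
  (s = 1 \/ t = 1 -> ef_length A B 1) /\
  (~ (s = 1 \/ t = 1) -> ef_length A B 2).
Proof.
move=> A B; have N0 : N 0 = opp (M 0).
  apply: neq_opp => e; move: MN0.
  by rewrite -e; case: (M 0) => -[] => [/(_ erefl)|_ /(_ erefl)].
have iA : inhabited A by apply: inhabited_lo_prod => i; apply: inhabited_lo_exp.
have iB : inhabited B by apply: inhabited_lo_prod => i; apply: inhabited_lo_exp.
have uA : unbounded (M 0) A by apply/has_succs_unbounded/has_succs_power_prod.
have sB : has_succs (opp (M 0)) B by rewrite -N0; apply: has_succs_power_prod.
split=> [st1|st].
  split=> //; first exact: ef_equiv1.
  case: st1 => [s1|t1].
    apply: (not_ef_equiv2 (b := M 0)); last exact: has_succs_unbounded.
    by rewrite /A s1; apply/has_origin_lo_exp/m_gt0.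
  (* With the orders exchanged, [B] has an origin in direction [N 0], and [A] is unbounded in the
     opposite direction [M 0]. *)
  move/ef_equiv_sym; apply: (not_ef_equiv2 (b := N 0)); last by rewrite N0 oppK.
  by rewrite /B t1; apply/has_origin_lo_exp/n_gt0.
have s_gt1 : 1 < s.
  by rewrite ltn_neqAle s_gt0 andbT eq_sym; apply/eqP => s1; case: st; left.
have t_gt1 : 1 < t.
  by rewrite ltn_neqAle t_gt0 andbT eq_sym; apply/eqP => t1; case: st; right.
split=> //.
  by apply: ef_equiv2 => //; apply: unbounded_power_prod => //; [apply: M_alt|apply: N_alt].
by apply: not_ef_equiv3 sB; apply: has_limit_power_prod.
Qed.
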